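(* Let $n,a,b\geq 1$ be integers with $n\geq 5$, and let $V_1,V_2$ be disjoint sets with $|V_1|=an$ and $|V_2|=bn$. Let $\mathcal{H}\subseteq\binom{V_1}{a}\sqcup\binom{V_2}{b}$. If there exists $\alpha\in(0,1)$ such that \[ \delta_a(\mathcal{H})\geq\Big(\alpha+4\sqrt{\log n/n}\Big)\binom{bn}{b} \quad\text{and}\quad \delta_b(\mathcal{H})\geq\Big(1-\alpha+4\sqrt{\log n/n}\Big)\binom{an}{a}, \] then $\mathcal{H}$ contains a Hamilton $(a,b)$-cycle.
   Context: $\binom{V_1}{a}\sqcup\binom{V_2}{b}$ denotes the family of all subsets $F\subseteq V_1\cup V_2$ with $|F\cap V_1|=a$ and $|F\cap V_2|=b$; $\mathcal{H}$ is regarded as an $(a+b)$-uniform hypergraph with vertex set $V_1\cup V_2$. Here $\delta_a(\mathcal{H})$ is the minimum, over all $a$-subsets $A\subseteq V_1$, of the number of edges of $\mathcal{H}$ containing $A$, and $\delta_b(\mathcal{H})$ is the minimum, over all $b$-subsets $B\subseteq V_2$, of the number of edges of $\mathcal{H}$ containing $B$. With $k=a+b$, a $k$-uniform hypergraph is an $(a,b)$-cycle if there is a partition $(A_0,B_0,A_1,B_1,\dots,A_{t-1},B_{t-1})$ of its vertex set with $|A_i|=a$, $|B_i|=b$ such that $A_i\cup B_i$ and $B_i\cup A_{i+1}$ (indices modulo $t$) are edges for all $i=0,\dots,t-1$. $\mathcal{H}$ contains a Hamilton $(a,b)$-cycle if some subhypergraph of $\mathcal{H}$ is an $(a,b)$-cycle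 covering all vertices $V_1\cup V_2$. *)

(* Defs.v *)
From mathcomp Require Import all_boot.
From Stdlib Require Import Reals.
Set Implicit Arguments. Unset Strict Implicit. Unset Printing Implicit Defensive.

Section Defs.
Variables (V1 V2 : finType).
Local Notation V := (V1 + V2)%type.

Definition in_bip_family (a b : nat) (H : {set {set V}}) : Prop :=
  forall F, F \in H -> #|inl @^-1: F| = a /\ #|inr @^-1: F| = b.

Definition degA (H : {set {set V}}) (A : {set V1}) : nat :=
  #|[set F in H | (inl @: A) \subset F]|.
Definition degB (H : {set {set V}}) (B : {set V2}) : nat :=
  #|[set F in H | (inr @: B) \subset F]|.

Definition has_hamilton_ab_cycle (a b : nat) (H : {set {set V}}) : Prop :=
  exists (t : nat) (A B : 'I_t -> {set V}),
    [/\ forall i, #|A i| = a /\ #|B i| = b,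
        forall i j, i != j -> [disjoint A i & A j] /\ [disjoint B i & B j],
        forall i j, [disjoint A i & B j],
        \bigcup_(i < t) (A i :|: B i) = [set: V] &
        forall i, (A i :|: B i) \in H /\ (B i :|: A (ordS i)) \in H].
End Defs.

(* Main.v *)
(** Cut V_1 at random into n blocks X_i of size a and V_2 into n blocks Y_j of
    size b, and join X_i to Y_j when their union is an edge.  If every degree of
    this bipartite graph is close to its mean, the degrees of any X_i and any
    Y_j add up to more than n, so by Moon and Moser the graph has a Hamilton
    cycle, which is a Hamilton (a,b)-cycle of H.

    The concentration has to be independent of a and b, which rules out
    bounded differences.  It follows instead from the inequality
      E \prod_i f_i(X_i) <= \prod_i ||f_i||_2
    for the blocks of a random ordered partition, which makes the exponential
    moments of the degrees behave as for independent blocks.  It is proved by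
    colouring the elements one at a time; one step is the inequality
      (\sum_i p_i u_i \prod_(j != i) v_j)^2
        <= \prod_i (p_i u_i^2 + (1 - p_i) v_i^2)
    for probability vectors p, obtained by merging two colours at a time.  With
    s = sqrt (log n / n) and f = exp (s * indicator), a given degree fails with
    probability at most exp (- 4/3 n s^2) = n^(-4/3); summing over the 2n
    blocks gives less than 1. *)
Require Import Defs.
From mathcomp Require Import all_boot all_order all_algebra.
From mathcomp Require Import Rstruct zify.
From Stdlib Require Import Reals.
From mathcomp Require Import ring lra.
Set Implicit Arguments. Unset Strict Implicit. Unset Printing Implicit Defensive.
Import Order.TTheory GRing.Theory Num.Theory.

(** * Random ordered partitions *)

Section Averages.
Local Open Scope ring_scope.
Local Delimit Scope nat_scope with N.
Variables (R : rcfType) (I : finType).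
Implicit Types (T : finType) (c : I -> nat).

Definition add_elt T (x : T) (i : I) (X : I -> {set T}) : I -> {set T} :=
  fun j => if j == i then x |: X j else X j.

(* Expectation of [F] over a uniform colouring of [s] with [c i] elements of
   colour [i], drawn by colouring the elements of [s] in turn; meaningful when
   the [c i] add up to [size s]. *)
Fixpoint colavg T (s : seq T) c (F : (I -> {set T}) -> R) : R :=
  if s is x :: s' then
    \sum_i (c i)%:R / (size s)%:R *
      colavg s' (fun j => c j - (j == i))%N (fun X => F (add_elt x i X))
  else F (fun=> set0).

(* Mean of [f] over the [k]-subsets of [s]; see [setavgE]. *)
Fixpoint setavg T (s : seq T) (k : nat) (f : {set T} -> R) : R :=
  if s is x :: s' then
    k%:R / (size s)%:R * setavg s' k.-1 (fun B => f (x |: B)) +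
    (size s - k)%:R / (size s)%:R * setavg s' k f
  else f set0.

Definition blocks T (s : seq T) c (X : I -> {set T}) : Prop :=
  [/\ forall i, #|X i| = c i, forall i j, i != j -> [disjoint X i & X j]
    & forall i, {subset X i <= s}].

Lemma eq_colavg T (s : seq T) c F G : F =1 G -> colavg s c F = colavg s c G.
Proof.
elim: s c F G => [|x s IH] c F G FG /=; first exact: FG.
by apply: eq_bigr => i _; congr (_ * _); apply: IH => X; apply: FG.
Qed.

Lemma colavg_lin T (s : seq T) c (J : finType) (a : J -> R)
    (F : J -> (I -> {set T}) -> R) :
  colavg s c (fun X => \sum_j a j * F j X) = \sum_j a j * colavg s c (F j).
Proof.
elim: s c F => [|x s IH] c F //=.
under eq_bigr => i _ do rewrite IH mulr_sumr.
rewrite exchange_big /=; apply: eq_bigr => j _.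
by rewrite mulr_sumr; apply: eq_bigr => i _; rewrite mulrCA.
Qed.

Lemma colavg_sum T (s : seq T) c (J : finType) (F : J -> (I -> {set T}) -> R) :
  colavg s c (fun X => \sum_j F j X) = \sum_j colavg s c (F j).
Proof.
transitivity (\sum_j 1 * colavg s c (F j)).
  by rewrite -colavg_lin; apply: eq_colavg => X; apply: eq_bigr => j _; rewrite mul1r.
by apply: eq_bigr => j _; rewrite mul1r.
Qed.

Lemma colavgZ T (s : seq T) c (a : R) F :
  colavg s c (fun X => a * F X) = a * colavg s c F.
Proof.
have := colavg_lin s c (fun _ : 'I_1 => a) (fun _ => F).
by rewrite big_ord1 => <-; apply: eq_colavg => X; rewrite big_ord1.
Qed.

Lemma colavgD T (s : seq T) c F G :
  colavg s c (fun X => F X + G X) = colavg s c F + colavg s c G.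
Proof.
have := colavg_sum s c (fun b : bool => if b then F else G).
by rewrite big_bool /= => <-; apply: eq_colavg => X; rewrite big_bool.
Qed.

(** Fubini for two independent partitions: a block of either side can be held fixed while the other
    side is averaged. *)
Lemma colavg_exchange (T U : finType) (s : seq T) (t : seq U) c d
    (F : (I -> {set T}) -> (I -> {set U}) -> R) :
  colavg s c (fun X => colavg t d (F X)) =
  colavg t d (fun Y => colavg s c (F^~ Y)).
Proof.
elim: s c F => [|x s IH] c F //=.
rewrite colavg_lin; apply: eq_bigr => i _.
by rewrite (IH _ (fun X => F (add_elt x i X))).
Qed.

Lemma sum_subn_delta c i : (0 < c i)%N ->
  (\sum_j (c j - (j == i)) = (\sum_j c j).-1)%N.
Proof.
move=> ci; rewrite (bigD1 i) //= eqxx [in RHS](bigD1 i) //=.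
rewrite subn1 -[c i in RHS]prednK //=; congr (_ + _)%N.
by apply: eq_bigr => j /negbTE ->; rewrite subn0.
Qed.

Lemma colavg_cst T (s : seq T) c (a : R) : (\sum_i c i)%N = size s ->
  colavg s c (fun=> a) = a.
Proof.
elim: s c => [|x s IH] c //= Hc.
transitivity (\sum_i (c i)%:R / (size s).+1%:R * a).
  apply: eq_bigr => i _; case: (posnP (c i)) => [->|ci]; first by rewrite !mul0r.
  by rewrite IH // sum_subn_delta // Hc.
by rewrite -!mulr_suml -natr_sum Hc divff ?mul1r // pnatr_eq0.
Qed.

(** The probabilistic method: at each element some colour of positive weight preserves the strict
    inequality. Positive weight means [0 < c i], so the truncated subtraction [c j - (j == i)] is
    exact along the chosen branch. *)
Lemma colavg_lt T (s : seq T) c F G : uniq s -> (\sum_i c i)%N = size s ->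
  colavg s c F < colavg s c G -> exists2 X, blocks s c X & F X < G X.
Proof.
elim: s c F G => [|x s IH] c F G /=.
  move=> _ /eqP; rewrite sum_nat_eq0 => /forallP Hc FG.
  exists (fun=> set0) => //; split=> [i|i j _|i y]; last by rewrite inE.
    by rewrite cards0 (eqP (Hc i)).
  by rewrite -setI_eq0 set0I.
move=> /andP[xs us] Hc FG.
have [i /andP[ci lti]] : exists i, (0 < c i)%N &&
  (colavg s (fun j => c j - (j == i))%N (fun X => F (add_elt x i X))
   < colavg s (fun j => c j - (j == i))%N (fun X => G (add_elt x i X))).
  apply/existsP; apply: contraLR FG => /existsPn H; rewrite -leNgt.
  apply: ler_sum => i _; move: (H i); case: posnP => [->|_ /=].
    by rewrite !mul0r.
  by rewrite -leNgt => Hi; apply: ler_wpM2l => //; rewrite divr_ge0.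
have [] := IH _ _ _ us _ lti; first by rewrite sum_subn_delta // Hc.
move=> X [cX dX sX] ltX; exists (add_elt x i X) => //.
have xX j : x \notin X j by apply: contra xs => /sX.
split=> [j|j k jk|j y]; rewrite /add_elt.
- case: eqP => [->|/eqP/negbTE ji]; last by rewrite cX ji subn0.
  by rewrite cardsU1 xX cX eqxx subn1 add1n prednK.
- case: eqP => [ji|_]; case: eqP => [ki|_]; last exact: dX.
  + by rewrite ji ki eqxx in jk.
  + rewrite disjoint_sym disjoints_subset; apply/subsetP => y yk.
    rewrite !inE negb_or; apply/andP; split.
      by apply: contraNneq (xX k) => <-.
    move: (dX j k jk); rewrite disjoint_sym disjoints_subset => /subsetP/(_ y yk).
    by rewrite inE.
  + rewrite disjoints_subset; apply/subsetP => y yj.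
    rewrite !inE negb_or; apply/andP; split.
      by apply: contraNneq (xX j) => <-.
    by move: (dX j k jk); rewrite disjoints_subset => /subsetP/(_ y yj); rewrite inE.
- case: eqP => _; rewrite !inE; first by case/orP=> [->//|/sX->]; rewrite orbT.
  by move/sX->; rewrite orbT.
Qed.

Lemma colavg_le T (s : seq T) c F (a : R) : uniq s -> (\sum_i c i)%N = size s ->
  (forall X, blocks s c X -> F X <= a) -> colavg s c F <= a.
Proof.
move=> us Hc HF; rewrite leNgt; apply/negP.
rewrite -{1}(colavg_cst a Hc) => /(colavg_lt us Hc)[X /HF].
by rewrite leNgt => /negP.
Qed.

Lemma setavg_ge0 T (s : seq T) k f : (forall B, 0 <= f B) -> 0 <= setavg s k f.
Proof.
elim: s k f => [|x s IH] k f f0 /=; first exact: f0.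
by rewrite addr_ge0 // mulr_ge0 ?divr_ge0 ?IH.
Qed.

(** Splitting the [k]-sets by membership of the head gives the two terms of the recursion, up to the
    absorption identities for binomials. With the binomial as a factor, the case [size s < k] reads
    [0 = 0]. *)
Lemma setavgE T (s : seq T) k f : uniq s ->
  setavg s k f * 'C(size s, k)%:R =
  \sum_(B : {set T} | (B \subset s) && (#|B| == k)) f B.
Proof.
elim: s k f => [|x s IH] k f /=.
  move=> _; case: k => [|k].
    rewrite bin0 mulr1 (big_pred1 set0) // => B; rewrite cards_eq0.
    rewrite /=; case: (eqVneq B set0) => [->|]; rewrite ?andbF // andbT.
    by apply/subsetP => y; rewrite inE.
  rewrite bin0n mulr0 big_pred0 // => B.
  apply/negbTE/negP=> /andP[/subset_leq_card + /eqP Bk].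
  by rewrite Bk card0.
move=> /andP[xs us].
have N0 : (size s).+1%:R != 0 :> R by rewrite pnatr_eq0.
rewrite [RHS](bigID (fun B : {set T} => x \in B)) /= mulrDl; congr (_ + _).
  case: k => [|k].
    rewrite !mul0r big_pred0 // => B; rewrite cards_eq0.
    by case: (eqVneq B set0) => [->|]; rewrite ?inE ?andbF.
  rewrite (reindex_onto (fun B => x |: B) (fun B => B :\ x)) /=; last first.
    by move=> B /andP[_ xB]; rewrite setD1K.
  transitivity (setavg s k (fun B => f (x |: B)) * 'C(size s, k)%:R).
    rewrite mulrAC [RHS]mulrC; congr (_ * _); rewrite mulrAC -natrM.
    by rewrite -mul_bin_diag natrM mulrAC divff // mul1r.
  rewrite IH //; apply: eq_bigl => B; rewrite setU11 andbT.
  case: (boolP (x \in B)) => xB.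
    rewrite (_ : (_ :\ x == B) = false) ?andbF; last first.
      by apply/negbTE/eqP=> eqB; have := setD11 x (x |: B); rewrite eqB xB.
    by apply/negbTE; apply: contra xs => /andP[/subsetP/(_ x xB)].
  rewrite setU1K // eqxx andbT cardsU1 xB eqSS; congr (_ && _).
  apply/subsetP/subsetP=> H y.
    by rewrite !inE => /orP[->//|/H->]; rewrite orbT.
  move=> yB; have := H y; rewrite !inE yB orbT => /(_ isT)/orP[/eqP yx|//].
  by rewrite -yx yB in xB.
transitivity (setavg s k f * 'C(size s, k)%:R).
  rewrite mulrAC [RHS]mulrC; congr (_ * _); rewrite mulrAC -natrM.
  by rewrite -mul_bin_down natrM mulrAC divff // mul1r.
rewrite IH //; apply: eq_bigl => B; case: (boolP (x \in B)) => xB.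
  by rewrite andbF; apply/negbTE; apply: contra xs => /andP[/subsetP/(_ x xB)].
rewrite andbT; congr (_ && _); apply/subsetP/subsetP=> H y yB.
  by rewrite inE H // orbT.
by have := H y yB; rewrite inE => /orP[/eqP yx|//]; rewrite -yx yB in xB.
Qed.

End Averages.

(** * The Brascamp-Lieb inequality *)

Section BrascampLieb.
Local Open Scope ring_scope.
Local Delimit Scope nat_scope with N.
Variables (R : rcfType) (I : finType).

(* [S] and [V] stand for the sum and the product over the colours merged so
   far, of total weight [p]; [V] and [S / p] play the roles of [v] and [u]. *)
Lemma merge_colours (p q S V P u v : R) :
  0 <= p -> 0 <= q -> p + q <= 1 ->
  (1 - p) * V ^+ 2 <= P -> S ^+ 2 <= p * (P - (1 - p) * V ^+ 2) ->
  (S * v + q * u * V) ^+ 2 <=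
  (p + q) * (P * (q * u ^+ 2 + (1 - q) * v ^+ 2)
             - (1 - (p + q)) * (V * v) ^+ 2).
Proof.
move=> p0 q0 pq1 VP SP.
have k0 := addr_ge0 p0 q0.
have W0 : 0 <= q * u ^+ 2 + (1 - q) * v ^+ 2.
  by apply: addr_ge0; apply: mulr_ge0; rewrite ?sqr_ge0 //; lra.
have [p_eq0|pn0] := eqVneq p 0.
  have S0 : S = 0.
    by apply/eqP; rewrite -sqrf_eq0 eq_le sqr_ge0 andbT (le_trans SP) // p_eq0 mul0r.
  have VP' : V ^+ 2 <= P by move: VP; rewrite p_eq0 subr0 mul1r.
  have := ler_wpM2l q0 (ler_wpM2r W0 VP').
  rewrite p_eq0 S0; lra.
have pp : 0 < p by rewrite lt_def pn0.
set U := S / p; have SE : S = p * U by rewrite mulrC divfK.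
have PU : p * U ^+ 2 + (1 - p) * V ^+ 2 <= P.
  by rewrite -(ler_pM2l pp); move: SP; rewrite SE; lra.
have H1 := ler_wpM2l k0 (ler_wpM2r W0 PU).
have k1 : 0 <= 1 - (p + q) by rewrite subr_ge0.
(* Once [P] is replaced by its lower bound [PU], the difference of the two sides of the goal is
   exactly this product. *)
have H2 := mulr_ge0 (mulr_ge0 p0 q0)
  (addr_ge0 (mulr_ge0 k1 (sqr_ge0 (U * v - u * V)))
            (mulr_ge0 k0 (sqr_ge0 (U * u - V * v)))).
rewrite SE; lra.
Qed.

Lemma sum_prod_le_sqrt (p u v : I -> R) :
  (forall i, 0 <= p i) -> \sum_i p i = 1 ->
  \sum_i p i * (u i * \prod_(j | j != i) v j) <=
  \prod_i Num.sqrt (p i * u i ^+ 2 + (1 - p i) * v i ^+ 2).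
Proof.
move=> p0 p1.
have ple r : uniq r -> \sum_(i <- r) p i <= 1.
  move=> ur; rewrite -p1 big_uniq //= [leRHS](bigID (mem r)) /=.
  by rewrite lerDl sumr_ge0.
pose w i := p i * u i ^+ 2 + (1 - p i) * v i ^+ 2.
have pi1 i : p i <= 1 by have := ple [:: i] isT; rewrite big_seq1.
have w0 i : 0 <= w i.
  by apply: addr_ge0; apply: mulr_ge0; rewrite ?sqr_ge0 // subr_ge0.
(* The second part is the hypothesis of [merge_colours] for the colours in [r]; the first says that
   its bracket is nonnegative. For the full list the weights add up to 1, so the second part becomes
   the square of the claim. *)
have main r : uniq r ->
    (1 - \sum_(i <- r) p i) * (\prod_(j <- r) v j) ^+ 2 <= \prod_(i <- r) w i /\
    (\sum_(i <- r) p i * (u i * \prod_(j <- r | j != i) v j)) ^+ 2 <=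
    (\sum_(i <- r) p i) *
      (\prod_(i <- r) w i - (1 - \sum_(i <- r) p i) * (\prod_(j <- r) v j) ^+ 2).
  elim: r => [|i r IH]; first by rewrite !big_nil; split; lra.
  move=> uir; have /andP[ir ur] := uir; have [IH1 IH2] := IH ur.
  have le1 := ple _ uir; rewrite big_cons in le1.
  have Ei : \prod_(j <- r | j != i) v j = \prod_(j <- r) v j.
    rewrite -big_filter; congr bigop; apply/all_filterP/allP => j jr.
    by apply: contraNneq ir => <-.
  have Es : \sum_(k <- r) p k * (u k * \prod_(j <- i :: r | j != k) v j) =
            (\sum_(k <- r) p k * (u k * \prod_(j <- r | j != k) v j)) * v i.
    rewrite mulr_suml; apply: eq_big_seq => k kr; rewrite big_cons ifT.
      by ring.
    by apply: contraNneq ir => ->.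
  rewrite big_cons [X in _ /\ X ^+ 2 <= _]big_cons Es !big_cons eqxx /= Ei.
  move: IH1 IH2 le1.
  set P := \prod_(j <- r) w j; set V := \prod_(j <- r) v j.
  set q := \sum_(j <- r) p j; set S := \sum_(j <- r) _ => IH1 IH2 le1.
  have q0 : 0 <= q by apply: sumr_ge0.
  have M : (S * v i + p i * u i * V) ^+ 2 <= (q + p i) *
       (P * (p i * u i ^+ 2 + (1 - p i) * v i ^+ 2)
        - (1 - (q + p i)) * (V * v i) ^+ 2).
    by apply: merge_colours => //; rewrite addrC.
  split; last by move: M; congr (_ <= _); rewrite /w; ring.
  rewrite -subr_ge0 (_ : _ - _ = w i * (P - (1 - q) * V ^+ 2) +
    q * p i * (V * v i) ^+ 2 + (1 - q) * (p i * (V * u i) ^+ 2)); last first.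
    by rewrite /w; ring.
  have q1 : 0 <= 1 - q by rewrite subr_ge0 (le_trans _ le1) // lerDr.
  apply: addr_ge0; last by rewrite mulr_ge0 // mulr_ge0 // sqr_ge0.
  by apply: addr_ge0; rewrite mulr_ge0 ?subr_ge0 ?sqr_ge0 // mulr_ge0.
have [_] := main _ (index_enum_uniq I).
rewrite p1 subrr mul0r subr0 mul1r => H.
apply: le_trans (ler_norm _) _.
rewrite -(@ler_pXn2r _ 2) ?nnegrE ?normr_ge0 ?prodr_ge0 ?real_normK ?num_real //.
  rewrite (le_trans H) // -prodrXl; apply: ler_prod => i _.
  by rewrite sqr_sqrtr ?w0 /=.
by move=> i _; apply: sqrtr_ge0.
Qed.

Lemma colavg_prod_le (T : finType) (s : seq T) (c : I -> nat)
    (f : I -> {set T} -> R) :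
  (\sum_i c i)%N = size s -> (forall i B, 0 <= f i B) ->
  colavg s c (fun X => \prod_i f i (X i)) <=
  \prod_i Num.sqrt (setavg s (c i) (fun B => f i B ^+ 2)).
Proof.
elim: s c f => [|x s IH] c f /= Hc f0.
  by apply: ler_prod => i _; rewrite sqrtr_sqr ger0_norm ?f0 ?lexx.
have N0 : (size s).+1%:R != 0 :> R by rewrite pnatr_eq0.
have cle i : (c i <= (size s).+1)%N by rewrite -Hc (bigD1 i) //= leq_addr.
pose p i : R := (c i)%:R / (size s).+1%:R.
(* [u i] and [v i] are the L2 norms of [f i] conditioned on [x] being inside or outside block [i];
   mixing their squares with weights [p i] and [1 - p i] recovers the full squared norm. *)
pose u i := Num.sqrt (setavg s (c i).-1 (fun B => f i (x |: B) ^+ 2)).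
pose v i := Num.sqrt (setavg s (c i) (fun B => f i B ^+ 2)).
have p0 i : 0 <= p i by rewrite divr_ge0.
have p1 : \sum_i p i = 1 by rewrite -mulr_suml -natr_sum Hc divff.
have -> : \prod_i Num.sqrt (setavg (x :: s) (c i) (fun B => f i B ^+ 2)) =
          \prod_i Num.sqrt (p i * u i ^+ 2 + (1 - p i) * v i ^+ 2).
  apply: eq_bigr => i _; rewrite /= !sqr_sqrtr ?setavg_ge0 //;
    try by move=> B; apply: sqr_ge0.
  by rewrite natrB // mulrBl divff.
apply: le_trans (sum_prod_le_sqrt u v p0 p1); apply: ler_sum => i _.
case: (posnP (c i)) => [ci0|ci]; first by rewrite /p ci0 !mul0r.
apply: ler_wpM2l; first exact: p0.
(* Giving [x] colour [i] is absorbed into the [i]-th function, which puts the average in the form of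
   the induction hypothesis. *)
pose g j B := if j == i then f j (x |: B) else f j B.
rewrite (eq_colavg _ _ (G := fun X => \prod_j g j (X j))); last first.
  by move=> X; apply: eq_bigr => j _; rewrite /add_elt /g; case: eqP.
apply: le_trans (IH _ g _ _) _; first by rewrite sum_subn_delta // Hc.
  by move=> j B; rewrite /g; case: eqP.
rewrite (bigD1 i) //= eqxx subn1 /g eqxx; apply: ler_wpM2l; first exact: sqrtr_ge0.
by rewrite (eq_bigr v) // => j /negbTE ->; rewrite subn0.
Qed.

End BrascampLieb.

(** * Concentration *)

Section Chernoff.
Local Open Scope ring_scope.
Local Delimit Scope nat_scope with N.
Local Arguments exp : clear scopes.

Lemma expD (x y : R) : exp (x + y) = exp x * exp y.
Proof. exact: exp_plus. Qed.

Lemma expMn (x : R) n : exp (x * n%:R) = exp x ^+ n.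
Proof.
elim: n => [|n IH]; first by rewrite mulr0 expr0 exp_0.
by rewrite -natr1 mulrDr mulr1 expD IH exprSr.
Qed.

Lemma exp_gt0 (x : R) : 0 < exp x.
Proof. exact/RltP/exp_pos. Qed.

Lemma exp_ge1Dx (x : R) : 1 + x <= exp x.
Proof. exact/RleP/exp_ineq1_le. Qed.

(** From [1 - x <= exp (- x)] it follows that [(1 - x) * exp x <= 1], while [1 - x] times the
    right-hand side is [1 + x ^ 2 * (1 / 3 - 4 / 3 * x)], at least 1 for [x <= 1 / 4]. *)
Lemma exp_le_quadratic (x : R) : 0 <= x -> x <= 1 / 4 ->
  exp x <= 1 + x + 4 / 3 * x ^+ 2.
Proof.
move=> x0 x4; have x1 : 0 < 1 - x by lra.
rewrite -(ler_pM2l x1) (@le_trans _ _ 1) //.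
  have E : exp (- x) * exp x = 1 by rewrite -expD addNr exp_0.
  by rewrite -[leRHS]E ler_pM2r ?exp_gt0 // exp_ge1Dx.
have : 0 <= x ^+ 2 * (1 / 3 - 4 / 3 * x) by rewrite mulr_ge0 ?sqr_ge0; lra.
lra.
Qed.

Lemma colavg_exp_le (n b : nat) (T : finType) (P : pred {set T}) (s Q : R) :
  (0 < n)%N -> #|T| = (b * n)%N -> 0 <= s -> s <= 1 / 8 -> Q <= 1 ->
  #|[set B : {set T} | (#|B| == b) && P B]|%:R <= Q * 'C(b * n, b)%:R ->
  colavg (enum T) (fun _ : 'I_n => b)
    (fun X => exp (s * ((\sum_j P (X j))%N%:R - (Q + 4 * s) * n%:R))) <=
  exp (- (4 / 3 * n%:R * s ^+ 2)).
Proof.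
move=> n0 cT s0 s8 Q1 cP.
pose f (_ : 'I_n) (B : {set T}) := exp (s *+ P B).
have szT : size (enum T) = (b * n)%N by rewrite -cardE.
rewrite (eq_colavg _ _ (G := fun X => exp (- (s * ((Q + 4 * s) * n%:R))) *
    \prod_j f j (X j))); last first.
  move=> X; rewrite mulrBr addrC expD; congr (_ * _).
  rewrite natr_sum mulr_sumr (big_morph exp expD exp_0).
  by apply: eq_bigr => j _; rewrite mulr_natr.
(* By [exp_le_quadratic] at [2 * s], whence [s <= 1 / 8], the mean of [f ^ 2] is at most
   [1 + Q * (2 * s + 16 / 3 * s ^ 2)], hence at most [w ^ 2] since [Q <= 1]. The product of [n]
   norms then leaves the exponent [(8 / 3 - 4) * n * s ^ 2]. *)
rewrite colavgZ; pose w := exp (Q * s + 8 / 3 * s ^+ 2).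
have f0 j B : 0 <= f j B by apply/ltW/exp_gt0.
have w0 : 0 <= w by apply/ltW/exp_gt0.
have C0 : 0 < 'C(b * n, b)%:R :> R by rewrite ltr0n bin_gt0 leq_pmulr.
have Q0 : 0 <= Q by rewrite -(pmulr_lge0 _ C0) (le_trans _ cP).
have E2 : exp (s *+ 2) <= 1 + s *+ 2 + 4 / 3 * (s *+ 2) ^+ 2.
  by apply: exp_le_quadratic; rewrite mulr2n; lra.
have E1 : 0 <= exp (s *+ 2) - 1.
  by rewrite subr_ge0 (le_trans _ (exp_ge1Dx _)) // lerDl mulrn_wge0.
have avg j : setavg (enum T) b (fun B => f j B ^+ 2) <= w ^+ 2.
  have expw : 1 + Q * (exp (s *+ 2) - 1) <= w ^+ 2.
    rewrite expRX (le_trans _ (exp_ge1Dx _)) // lerD2l.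
    have := ler_wpM2l Q0 E2; have := ler_wpM2r (sqr_ge0 s) Q1.
    by rewrite [s *+ 2]mulr2n; move: (exp _) => e; lra.
  apply: le_trans expw; rewrite -(ler_pM2r C0) -szT setavgE ?enum_uniq // szT.
  rewrite (eq_bigr (fun B => 1 + (exp (s *+ 2) - 1) * (P B)%:R)); last first.
    move=> B _; rewrite /f expRX; case: (P B); rewrite ?mulr1 ?mulr0.
      by rewrite mulr1n addrC subrK.
    by rewrite mulr0n mul0rn exp_0 addr0.
  rewrite (eq_bigl (fun B : {set T} => #|B| == b)); last first.
    move=> B; rewrite (_ : B \subset _) //.
    by apply/subsetP => y _; rewrite mem_enum.
  rewrite big_split /= sumr_const -mulr_sumr.
  rewrite (_ : #|_| = 'C(b * n, b)); last by rewrite -cT -card_draws cardsE.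
  rewrite (_ : \sum_(B | _) _ = #|[set B : {set T} | (#|B| == b) && P B]|%:R).
    have := ler_wpM2l E1 cP; move: (exp _) (_%:R) ('C(_, _)%:R) => e z C H; lra.
  rewrite -sum1_card natr_sum [RHS](eq_bigl (fun B : {set T} => (#|B| == b) && P B)).
    by rewrite big_mkcondr; apply: eq_bigr => B _; case: (P B).
  by move=> B; rewrite inE.
have step : colavg (enum T) (fun _ : 'I_n => b) (fun X => \prod_j f j (X j)) <= w ^+ n.
  apply: le_trans (colavg_prod_le _ f0) _.
    by rewrite sum_nat_const card_ord szT mulnC.
  have -> : w ^+ n = \prod_(j < n) w by rewrite prodr_const card_ord.
  apply: ler_prod => j _; rewrite sqrtr_ge0 -(ger0_norm w0) -sqrtr_sqr /=.
  exact: ler_wsqrtr.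
apply: le_trans (ler_wpM2l (ltW (exp_gt0 _)) step) _.
rewrite -expMn -expD le_eqVlt; apply/orP; left; apply/eqP; congr exp.
by field.
Qed.

End Chernoff.

(** * Hamilton cycles in bipartite graphs *)

Section Gaps.
Variables (T : eqType) (r : rel T).

Fixpoint gaps (x : T) (p : seq T) : nat :=
  if p is y :: p' then ~~ r x y + gaps y p' else 0.

Lemma gaps_eq0 x p : (gaps x p == 0) = path r x p.
Proof. by elim: p x => [|y p IH] x //=; rewrite addn_eq0 IH eqb0 negbK. Qed.

Lemma gaps_cat x p1 p2 : gaps x (p1 ++ p2) = gaps x p1 + gaps (last x p1) p2.
Proof. by elim: p1 x => [|y p IH] x //=; rewrite IH addnA. Qed.

Lemma gaps_rcons x p y : gaps x (rcons p y) = gaps x p + ~~ r (last x p) y.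
Proof. by rewrite -cats1 gaps_cat /= addn0. Qed.

Lemma not_path_split x p : ~~ path r x p ->
  exists p1 y p2, p = p1 ++ y :: p2 /\ ~~ r (last x p1) y.
Proof.
elim: p x => [|y p IH] x //=; rewrite negb_and => /orP[Nxy|/IH].
  by exists [::], y, p.
by move=> [p1 [z [p2 [-> Nz]]]]; exists (y :: p1), z, p2.
Qed.

Hypothesis r_sym : symmetric r.

Lemma gaps_rev x p : gaps (last x p) (rev (belast x p)) = gaps x p.
Proof.
elim: p x => [|y p IH] x //=.
rewrite rev_cons gaps_rcons IH addnC r_sym; congr (~~ r x _ + _).
case: p {IH} => [|z p] //=.
by rewrite rev_cons last_rcons.
Qed.

(** By symmetry the reversed tail keeps its inner gaps, so only the links at its two ends are new.
    This serves both for [e], to count gaps, and for [alt], to see that the new order still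
    alternates. *)
Lemma gaps_flip u q1 w q2 :
  gaps u (rcons (q1 ++ rev (w :: q2)) u) =
  gaps u q1 + ~~ r (last u q1) (last w q2) + gaps w q2 + ~~ r w u.
Proof.
rewrite gaps_rcons gaps_cat last_cat {2}rev_cons last_rcons.
by rewrite lastI rev_rcons /= gaps_rev addnA.
Qed.

End Gaps.

Lemma prev_at_split (T : eqType) (w y0 y : T) q1 q2 :
  w \notin q1 -> prev_at w y0 y (q1 ++ w :: q2) = last y q1.
Proof.
elim: q1 y => [|z q1 IH] y /=; first by rewrite eqxx.
by rewrite inE negb_or => /andP[/negbTE -> /IH].
Qed.

Section MoonMoser.
Variable n : nat.
Local Notation U := ('I_n + 'I_n)%type.

Definition side (z : U) : bool := if z is inl _ then true else false.
Definition alt : rel U := fun x y => side x != side y.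

Lemma alt_sym : symmetric alt. Proof. by move=> x y; rewrite /alt eq_sym. Qed.

Lemma card_side b : #|[set z : U | side z == b]| = n.
Proof.
rewrite -[RHS]card_ord; case: b.
  rewrite -(card_imset 'I_n (@inl_inj 'I_n 'I_n)); apply: eq_card => -[i|i].
    by rewrite !inE mem_imset //; apply: inl_inj.
  by rewrite !inE; apply/esym/negbTE/imsetP=> -[].
rewrite -(card_imset 'I_n (@inr_inj 'I_n 'I_n)); apply: eq_card => -[i|i].
  by rewrite !inE; apply/esym/negbTE/imsetP=> -[].
by rewrite !inE mem_imset //; apply: inr_inj.
Qed.

Lemma alternating_order :
  exists p : seq U, [/\ cycle alt p, uniq p & forall x, x \in p].
Proof.
pose f (s : seq 'I_n) : seq U := flatten [seq [:: inl i; inr i] | i <- s].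
have fin i s : i \in s -> (inl i \in f s) && (inr i \in f s).
  elim: s => [|j s IH] //; rewrite inE => /orP[/eqP ->|/IH].
    by rewrite !inE !eqxx !orbT.
  by rewrite !inE => /andP[-> ->]; rewrite !orbT.
have all_in x : x \in f (enum 'I_n).
  by case: x => i; have /andP[] := fin i (enum 'I_n) (mem_enum _ i).
exists (f (enum 'I_n)); split=> //.
- case: (enum 'I_n) => [|i s] //=.
  suff H k : path alt (inr k) (rcons (f s) (inl i)) by apply: H.
  by elim: s k => [|j s IH] k //=; apply: IH.
(* A sequence of length [2 * n] meeting all [2 * n] vertices has no repetition. *)
- apply/card_uniqP; rewrite (eq_card (B := [set: U])); last first.
    by move=> x; rewrite inE all_in.
  rewrite cardsT card_sum !card_ord size_flatten /shape -map_comp sumnE big_map.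
  rewrite (eq_bigr (fun=> 2)) // big_const_seq count_predT size_enum_ord.
  by rewrite iter_addn_0 mul2n addnn.
Qed.

Variable e : rel U.
Hypothesis e_sym : symmetric e.
Hypothesis e_alt : forall x y, e x y -> alt x y.
Hypothesis e_deg : forall x y, alt x y ->
  n < #|[set z | e x z]| + #|[set z | e y z]|.

(* With [v := last u q] not adjacent to [u], the degree condition gives
   consecutive [z, w] with [z] adjacent to [v] and [w] to [u]: reversing the
   segment from [w] to [v] closes the gap [v, u] without opening a new one. *)
Lemma reduce_gap u q :
  cycle alt (u :: q) -> uniq (u :: q) -> (forall x, x \in u :: q) ->
  ~~ e (last u q) u ->
  exists q', [/\ cycle alt (u :: q'), perm_eq (u :: q') (u :: q)
    & gaps e u (rcons q' u) < gaps e u (rcons q u)].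
Proof.
set p := u :: q; set v := last u q => cp up allp Nvu.
have vu : alt v u by move: cp; rewrite /= rcons_path => /andP[].
(* Neighbours of [u] and successors of neighbours of [v] all lie on the side of [v], which has [n]
   vertices. By [e_deg] the two sets have more than [n] elements in total, so they meet. *)
pose S := [set z | e u z]; pose T' := next p @: [set z | e v z].
have [w wS wT] : exists2 w, w \in S & w \in T'.
  have sub : S :|: T' \subset [set z | side z == side v].
    apply/subsetP => z; rewrite !inE => /orP[/e_alt|/imsetP[y]].
      by move: vu; rewrite /alt; case: (side u); case: (side v); case: (side z).
    rewrite inE => /e_alt vy ->; have := next_cycle cp (allp y).
    by move: vy; rewrite /alt; case: (side v); case: (side y); case: (side (next p y)).
  have : 0 < #|S :&: T'|.
    have := subset_leq_card sub; rewrite card_side.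
    have nextI : injective (next p) by apply: can_inj (prev_next up).
    have := e_deg vu; rewrite -(card_imset _ nextI) -/T' addnC -/S -cardsUI.
    by rewrite -[X in X < _]addn0 => H1 H2; rewrite -(ltn_add2l #|S :|: T'|)
      (leq_ltn_trans _ H1) // leq_add2r.
  by case/card_gt0P => w; rewrite inE => /andP[]; exists w.
move: wS wT; rewrite inE => euw /imsetP[z]; rewrite inE => evz wz.
have wu : w != u.
  by apply: contraTneq euw => ->; apply/negP => /e_alt; rewrite /alt eqxx.
have wq : w \in q by have := allp w; rewrite inE (negbTE wu).
have zE : z = prev p w by rewrite wz prev_next.
have [q1 [q2 qE]] : exists q1 q2, q = q1 ++ w :: q2.
  by case/splitPr: wq => q1 q2; exists q1, q2.
have zq1 : z = last u q1.
  rewrite zE /p /= qE prev_at_split //.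
  by move: up; rewrite /p qE /= cat_uniq /= negb_or => /and4P[_ _ /andP[]].
have vE : v = last w q2 by rewrite /v qE last_cat.
exists (q1 ++ rev (w :: q2)); split.
- rewrite /= -gaps_eq0 (gaps_flip alt_sym) -zq1 -vE.
  move: cp; rewrite /= -gaps_eq0 qE rcons_cat gaps_cat /= gaps_rcons.
  rewrite !addn_eq0 => /and3P[-> _ /andP[-> _]].
  by rewrite (alt_sym w) (e_alt euw) alt_sym (e_alt evz).
- by rewrite /p qE perm_cons perm_cat2l perm_rev.
- rewrite (gaps_flip e_sym) -zq1 -vE e_sym evz (e_sym w) euw.
  rewrite qE rcons_cat gaps_cat /= gaps_rcons -vE (negbTE Nvu).
  lia.
Qed.

Lemma hamilton_cycle_of_order m p :
  cycle alt p -> uniq p -> (forall x, x \in p) ->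
  (if p is x :: p' then gaps e x (rcons p' x) else 0) <= m ->
  exists c, [/\ cycle e c, uniq c & forall x, x \in c].
Proof.
elim: m p => [|m IH] p cp up allp gm.
  exists p; split=> //; case: p gm {cp up allp} => //= x p.
  by rewrite leqn0 gaps_eq0.
case: (boolP (cycle e p)) => [|Np]; first by exists p.
case: p cp up allp gm Np => [|x p] // cp up allp gm Np.
(* The order is rotated so that a gap becomes its closing link, as [reduce_gap] requires; rotation
   does not change the number of gaps. *)
have [u [q [cq qp gq Nq]]] : exists u q, [/\ cycle alt (u :: q),
    perm_eq (u :: q) (x :: p), gaps e u (rcons q u) <= m.+1 & ~~ e (last u q) u].
  have [q1 [y [q2 [pE Ny]]]] := not_path_split Np.
  case/lastP: q2 pE => [|q2 t] pE.
    move: pE; rewrite cats1 => /rcons_inj[pE xy].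
    by exists x, p; split=> //; rewrite pE {2}xy.
  move: pE; rewrite -rcons_cons -rcons_cat => /rcons_inj[pE xt].
  have rE : y :: q2 ++ x :: q1 = rot (size (x :: q1)) (x :: p).
    by rewrite pE -cat_cons rot_size_cat.
  exists y, (q2 ++ x :: q1); split.
  - by rewrite rE rot_cycle.
  - by rewrite rE perm_rot.
  - move: gm; rewrite pE !rcons_cat !gaps_cat /= !gaps_rcons.
    by rewrite addnA addnC -addnA.
  - by have := last_cat y q2 (x :: q1); rewrite /= => ->.
have uq : uniq (u :: q) by rewrite (perm_uniq qp).
have allq z : z \in u :: q by rewrite (perm_mem qp).
have [q' [cq' qq' lt]] := reduce_gap cq uq allq Nq.
apply: (IH (u :: q')) => //.
- by rewrite (perm_uniq qq').
- by move=> z; rewrite (perm_mem qq').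
- by rewrite -ltnS (leq_trans lt).
Qed.

Lemma moon_moser : exists c, [/\ cycle e c, uniq c & forall x, x \in c].
Proof.
have [p [cp up allp]] := alternating_order.
exact: (hamilton_cycle_of_order cp up allp (leqnn _)).
Qed.

End MoonMoser.

(** * Joining the blocks *)

Lemma cycle_nth (T : eqType) (r : rel T) x0 (c : seq T) k :
  cycle r c -> k < size c -> r (nth x0 c k) (nth x0 c (k.+1 %% size c)).
Proof.
case: c => [|x c] // /(pathP x0); rewrite size_rcons => H kc.
have := H k kc; rewrite -rcons_cons !nth_rcons kc; congr (r _ _).
case: ltngtP => [kc'|kc'|->]; first by rewrite modn_small.
  by move: kc; rewrite /= ltnS leqNgt kc'.
by rewrite modnn.
Qed.

Section Join.
Variables V1 V2 : finType.
Local Notation V := (V1 + V2)%type.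

Definition join (A : {set V1}) (B : {set V2}) : {set V} := inl @: A :|: inr @: B.

Lemma joinK (F : {set V}) : join (inl @^-1: F) (inr @^-1: F) = F.
Proof.
apply/setP => -[x|x]; rewrite inE.
  rewrite mem_imset ?inE; last exact: inl_inj.
  by rewrite [_ \in inr @: _](_ : _ = false) ?orbF //; apply/negbTE/imsetP => -[].
rewrite orbC mem_imset ?inE; last exact: inr_inj.
by rewrite [_ \in inl @: _](_ : _ = false) ?orbF //; apply/negbTE/imsetP => -[].
Qed.

(** An edge has exactly [a] elements in [V1], so one containing [A] meets [V1] in [A] and is
    determined by its trace on [V2]. *)
Lemma degA_le (a b : nat) (H : {set {set V}}) (A : {set V1}) :
  in_bip_family a b H -> #|A| = a ->
  degA H A <= #|[set B : {set V2} | (#|B| == b) && (join A B \in H)]|.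
Proof.
move=> HH cA; apply: leq_trans (leq_imset_card (join A) _).
apply/subset_leq_card/subsetP => F; rewrite inE => /andP[FH AF].
have [Fa Fb] := HH F FH.
have AE : A = inl @^-1: F.
  apply/eqP; rewrite eqEcard Fa cA leqnn andbT; apply/subsetP => x xA.
  by rewrite inE (subsetP AF) // imset_f.
apply/imsetP; exists (inr @^-1: F); last by rewrite AE joinK.
by rewrite inE Fb eqxx AE joinK.
Qed.

Lemma degB_le (a b : nat) (H : {set {set V}}) (B : {set V2}) :
  in_bip_family a b H -> #|B| = b ->
  degB H B <= #|[set A : {set V1} | (#|A| == a) && (join A B \in H)]|.
Proof.
move=> HH cB; apply: leq_trans (leq_imset_card (join^~ B) _).
apply/subset_leq_card/subsetP => F; rewrite inE => /andP[FH BF].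
have [Fa Fb] := HH F FH.
have BE : B = inr @^-1: F.
  apply/eqP; rewrite eqEcard Fb cB leqnn andbT; apply/subsetP => x xB.
  by rewrite inE (subsetP BF) // imset_f.
apply/imsetP; exists (inl @^-1: F); last by rewrite BE joinK.
by rewrite inE Fa eqxx BE joinK.
Qed.

Section Cycle.
Variables (n a b : nat) (H : {set {set V}}).
Variables (X : 'I_n -> {set V1}) (Y : 'I_n -> {set V2}).

Definition block_adj : rel ('I_n + 'I_n) := fun x y =>
  match x, y with
  | inl i, inr j | inr j, inl i => join (X i) (Y j) \in H
  | _, _ => false
  end.

Definition block (z : 'I_n + 'I_n) : {set V} :=
  match z with inl i => inl @: X i | inr j => inr @: Y j end.

Lemma block_adj_sym : symmetric block_adj.
Proof. by move=> [i|i] [j|j]. Qed.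

Lemma block_adj_alt x y : block_adj x y -> alt x y.
Proof. by case: x => i; case: y. Qed.

Lemma block_adjU x y : block_adj x y -> block x :|: block y \in H.
Proof. by case: x => i; case: y => j //=; rewrite // setUC. Qed.

(** Non-neighbours are counted because they are what the concentration bound controls from above. *)
Lemma block_degA i : #|[set z | block_adj (inl i) z]| +
  \sum_j (join (X i) (Y j) \notin H) = n.
Proof.
rewrite -sum1_card big_mkcond big_sumType /= big1 ?add0n; last first.
  by move=> j _; rewrite inE.
rewrite -big_split /= -[RHS]card_ord -sum1_card; apply: eq_bigr => j _.
by rewrite inE /=; case: (_ \in H).
Qed.

Lemma block_degB j : #|[set z | block_adj (inr j) z]| +
  \sum_i (join (X i) (Y j) \notin H) = n.
Proof.
rewrite -sum1_card big_mkcond big_sumType /= [X in _ + X + _]big1 ?addn0; last first.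
  by move=> i _; rewrite inE.
rewrite -big_split /= -[RHS]card_ord -sum1_card; apply: eq_bigr => i _.
by rewrite inE /=; case: (_ \in H).
Qed.

Lemma hamilton_of_block_cycle (c : seq ('I_n + 'I_n)) :
  0 < a -> 0 < b -> 0 < n ->
  #|V1| = a * n -> #|V2| = b * n ->
  blocks (enum V1) (fun=> a) X -> blocks (enum V2) (fun=> b) Y ->
  cycle block_adj c -> uniq c -> (forall z, z \in c) ->
  has_hamilton_ab_cycle a b H.
Proof.
move=> a0 b0 n0 cV1 cV2 [cX dX _] [cY dY _].
(* A cycle starting on the [V2] side is rotated by one step, since its second vertex is on the [V1]
   side. *)
wlog sc : c / (if c is inl _ :: _ then true else false) => [WL|] cc uc allc.
  case: c cc uc allc => [_ _ /(_ (inl (Ordinal n0))) //|[i|j] c] cc uc allc.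
    exact: (WL (inl i :: c)).
  apply: (WL (rot 1 (inr j :: c))).
  - rewrite rot1_cons; case: c cc {uc} allc => [_ /(_ (inl (Ordinal n0))) //|[//|k] c].
    by case/andP.
  - by rewrite rot_cycle.
  - by rewrite rot_uniq.
  - by move=> z; rewrite mem_rot.
have szc : size c = n.*2.
  rewrite -(card_uniqP uc) (eq_card (B := [set: 'I_n + 'I_n])).
    by rewrite cardsT card_sum card_ord addnn.
  by move=> z; rewrite inE allc.
pose z0 : 'I_n + 'I_n := inl (Ordinal n0); pose p k := nth z0 c k.
have adj k : k < n.*2 -> block_adj (p k) (p (k.+1 %% n.*2)).
  by rewrite -szc => kc; apply: cycle_nth.
have sp k : k < n.*2 -> side (p k) = ~~ odd k.
  elim: k => [|k IH] kn; first by move: sc; rewrite /p; case: (c) => [|[]].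
  have := block_adj_alt (adj k (ltnW kn)); rewrite modn_small // /alt IH 1?ltnW //.
  by rewrite /=; case: (odd k); case: (side _).
have disj x y : x != y -> [disjoint block x & block y].
  case: x => i; case: y => j ij;
    rewrite disjoints_subset; apply/subsetP => z /imsetP[v vi ->];
    rewrite inE; apply/imsetP => -[v' v'j //].
  - case=> vv'; have ij' : i != j by apply: contraNneq ij => ->.
    have := dX i j ij'; rewrite -setI_eq0 => /eqP/setP/(_ v).
    by rewrite !inE vi vv' v'j.
  - case=> vv'; have ij' : i != j by apply: contraNneq ij => ->.
    have := dY i j ij'; rewrite -setI_eq0 => /eqP/setP/(_ v).
    by rewrite !inE vi vv' v'j.
have pdisj k l : k < n.*2 -> l < n.*2 -> k != l -> [disjoint block (p k) & block (p l)].
  by move=> kn ln kl; apply: disj; rewrite nth_uniq ?szc.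
have cA x : side x -> #|block x| = a.
  by case: x => //= i _; rewrite card_imset ?cX //; apply: inl_inj.
have cB x : ~~ side x -> #|block x| = b.
  by case: x => //= i _; rewrite card_imset ?cY //; apply: inr_inj.
(* The blocks are disjoint with total size [a * n + b * n], the number of all vertices. *)
have cover : \bigcup_z block z = [set: V].
  apply/eqP; rewrite eqEcard subsetT /= cardsT card_sum cV1 cV2.
  rewrite -sum1_card partition_disjoint_bigcup // big_sumType /=.
  apply: leq_add.
    rewrite (eq_bigr (fun=> a)) ?sum_nat_const ?card_ord 1?mulnC // => i _.
    by rewrite sum1_card (cA (inl i)).
  rewrite (eq_bigr (fun=> b)) ?sum_nat_const ?card_ord 1?mulnC // => i _.
  by rewrite sum1_card (cB (inr i)).
have lt0 (i : 'I_n) : i.*2 < n.*2 by rewrite ltn_double.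
have lt1 (i : 'I_n) : i.*2.+1 < n.*2 by rewrite ltn_Sdouble.
exists n, (fun i => block (p i.*2)), (fun i => block (p i.*2.+1)); split.
- by move=> i; rewrite cA ?sp ?odd_double // cB // sp //= odd_double.
- move=> i j ij; split; apply: pdisj => //; last rewrite eqSS.
    by rewrite (inj_eq double_inj).
  by rewrite (inj_eq double_inj).
- by move=> i j; apply: pdisj => //; apply/eqP=> /(congr1 odd) /=; rewrite !odd_double.
- apply/setP => v; rewrite inE; apply/bigcupP.
  have : v \in \bigcup_z block z by rewrite cover inE.
  case/bigcupP => z _ vz; have kc : index z c < n.*2 by rewrite -szc index_mem.
  have kn : (index z c)./2 < n.
    by rewrite -ltn_double (leq_ltn_trans _ kc) // -[leqRHS]odd_double_half leq_addl.
  exists (Ordinal kn) => //; rewrite inE /=.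
  have pz : p (index z c) = z by rewrite /p nth_index.
  move: pz; rewrite -{1}[index z c]odd_double_half.
  by case: (odd _) => /= ->; rewrite vz ?orbT.
- move=> i; split; first by have := adj _ (lt0 i); rewrite modn_small // => /block_adjU.
  (* The successor of position [2 * i + 1] is [2 * i + 2] modulo [2 * n], which is twice [i + 1]
     modulo [n], the position of the block indexed by [ordS i]. *)
  have := block_adjU (adj _ (lt1 i)); congr (block _ :|: block (p _) \in H).
  by rewrite -doubleS -!muln2 -muln_modl.
Qed.
End Cycle.
End Join.

(** * Choice of the partitions and proof of the theorem *)

Section RandomBlocks.
Local Open Scope ring_scope.
Local Delimit Scope nat_scope with N.
Local Arguments exp : clear scopes.

(** The left-hand side is [2 * z] with [z] the inverse cube root of [N], so [N > 8] is what matters.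
    From [N >= 5] comes [ln N >= 1 - 1 / N >= 4 / 5], and [s <= 1 / 8] then forces
    [N >= 64 * ln N > 51]. *)
Lemma union_bound_lt1 (N s : R) : 5 <= N -> 0 <= s -> s <= 1 / 8 ->
  N * s ^+ 2 = ln N -> 2 * N * exp (- (4 / 3 * N * s ^+ 2)) < 1.
Proof.
move=> N5 s0 s8 ns; have n0 : 0 < N by lra.
move: (ln N) (exp_ln N (RltP n0)) ns => L eN ns.
have eL : exp (- L) = N^-1.
  apply: (mulfI (lt0r_neq0 n0)); rewrite divff ?lt0r_neq0 //.
  by rewrite -{1}eN -expD subrr exp_0.
have L45 : 4 / 5 <= L.
  have : 1 - L <= N^-1 by rewrite -eL; apply: exp_ge1Dx.
  have : N^-1 <= 5^-1 by rewrite lef_pV2 ?posrE //; lra.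
  by lra.
have N51 : 51 <= N.
  have H1 : N * s ^+ 2 <= N * (1 / 8) ^+ 2.
    by rewrite ler_pM2l // ler_pXn2r ?nnegrE //; lra.
  by move: H1; rewrite ns; lra.
pose z := exp (- L / 3%:R).
have z0 : 0 < z by apply: exp_gt0.
have z3 : z ^+ 3 = N^-1 by rewrite -eL /z -expMn divfK // pnatr_eq0.
have -> : exp (- (4 / 3 * N * s ^+ 2)) = N^-1 * z.
  rewrite -eL -expD; congr exp.
  by rewrite -ns; field.
rewrite -mulrA mulrA mulrA mulfK ?lt0r_neq0 //.
rewrite ltNge; apply/negP => z2.
clearbody z.
have z2' : 1 / 2 <= z by rewrite ler_pdivrMr ?ltr0n // mulrC.
have : (1 / 2) ^+ 3 <= z ^+ 3 by rewrite ler_pXn2r // nnegrE ?divr_ge0 // ltW.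
rewrite z3; have : N^-1 <= 51^-1 by rewrite lef_pV2 ?posrE //; lra.
by lra.
Qed.

(** Phrased with non-edges, only upper tails are needed. The slack [4 * s] pays for the deviation,
    and the resulting thresholds [(1 - alpha) * n] and [alpha * n] add up to [n]. *)
Lemma blocks_exist (n a b : nat) (V1 V2 : finType)
    (bad : {set V1} -> {set V2} -> bool) (alpha s : R) :
  (5 <= n)%N -> (0 < a)%N -> (0 < b)%N -> 
  #|V1| = (a * n)%N -> #|V2| = (b * n)%N ->
  0 < alpha -> alpha < 1 -> 0 <= s -> n%:R * s ^+ 2 = ln n%:R ->
  (forall A : {set V1}, #|A| = a ->
     #|[set B : {set V2} | (#|B| == b) && bad A B]|%:R
       <= (1 - alpha - 4 * s) * 'C(b * n, b)%:R) ->
  (forall B : {set V2}, #|B| = b ->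
     #|[set A : {set V1} | (#|A| == a) && bad A B]|%:R
       <= (alpha - 4 * s) * 'C(a * n, a)%:R) ->
  exists (X : 'I_n -> {set V1}) (Y : 'I_n -> {set V2}),
    [/\ blocks (enum V1) (fun=> a) X, blocks (enum V2) (fun=> b) Y &
      forall i j, (\sum_j' bad (X i) (Y j') + \sum_i' bad (X i') (Y j) < n)%N].
Proof.
move=> n5 a0 b0 cV1 cV2 al0 al1 s0 ns dA dB.
have n0 : (0 < n)%N by apply: leq_trans n5.
have N5 : 5 <= n%:R :> R by rewrite ler_nat.
have ex_sub (T : finType) k : (k * n)%N = #|T| -> exists B : {set T}, #|B| = k.
  move=> cT; have : (0 < #|[set B : {set T} | #|B| == k]|)%N.
    by rewrite card_draws -cT bin_gt0 leq_pmulr.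
  by case/card_gt0P => B; rewrite inE => /eqP; exists B.
(* The degrees do not exceed the number of k-subsets, whence [8 * s <= 1]. *)
have Q1_ge0 : 0 <= 1 - alpha - 4 * s.
  have [A cA] := ex_sub _ _ (esym cV1); have := le_trans (ler0n _ _) (dA A cA).
  by rewrite pmulr_lge0 // ltr0n bin_gt0 leq_pmulr.
have Q2_ge0 : 0 <= alpha - 4 * s.
  have [B cB] := ex_sub _ _ (esym cV2); have := le_trans (ler0n _ _) (dB B cB).
  by rewrite pmulr_lge0 // ltr0n bin_gt0 leq_pmulr.
have s8 : s <= 1 / 8 by lra.
set eps := exp (- (4 / 3 * n%:R * s ^+ 2)).
pose FA A (Y : 'I_n -> {set V2}) :=
  exp (s * ((\sum_j bad A (Y j))%N%:R - (1 - alpha - 4 * s + 4 * s) * n%:R)).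
pose FB B (X : 'I_n -> {set V1}) :=
  exp (s * ((\sum_i bad (X i) B)%N%:R - (alpha - 4 * s + 4 * s) * n%:R)).
have EA (A : {set V1}) : #|A| = a -> colavg (enum V2) (fun=> b) (FA A) <= eps.
  by move=> cA; apply: (colavg_exp_le (P := bad A)) => //; [lra|apply: dA].
have EB (B : {set V2}) : #|B| = b -> colavg (enum V1) (fun=> a) (FB B) <= eps.
  by move=> cB; apply: (colavg_exp_le (P := bad^~ B)) => //; [lra|apply: dB].
have sz1 : (\sum_(i < n) a)%N = size (enum V1).
  by rewrite sum_nat_const card_ord -cardE cV1 mulnC.
have sz2 : (\sum_(i < n) b)%N = size (enum V2).
  by rewrite sum_nat_const card_ord -cardE cV2 mulnC.
(* Markov's inequality and the union bound in one: all terms are nonnegative, so [G X Y < 1] makes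
   each of them less than 1, and every degree of non-edges stays below its threshold. *)
pose G X Y := \sum_i FA (X i) Y + \sum_j FB (Y j) X.
have EG : colavg (enum V1) (fun=> a)
    (fun X => colavg (enum V2) (fun=> b) (G X)) < 1.
  apply: le_lt_trans (union_bound_lt1 N5 s0 s8 ns); rewrite -/eps.
  have GE X : colavg (enum V2) (fun=> b) (G X) =
      \sum_i colavg (enum V2) (fun=> b) (FA (X i)) +
      colavg (enum V2) (fun=> b) (fun Y : 'I_n -> {set V2} => \sum_j FB (Y j) X).
    by rewrite /G colavgD colavg_sum.
  rewrite (eq_colavg _ _ GE).
  rewrite colavgD mulrDl mul1r mulrDl; apply: lerD.
    apply: colavg_le => //; first exact: enum_uniq.
    move=> X [cX _ _]; rewrite mulr_natl -[X in _ *+ X]card_ord -sumr_const.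
    by apply: ler_sum => i _; apply: EA.
  (* [EB] bounds an average over [X] for a fixed block of [Y], so the [Y]-average is moved
     outside. *)
  rewrite colavg_exchange; apply: colavg_le => //; first exact: enum_uniq.
  move=> Y [cY _ _]; rewrite colavg_sum mulr_natl -[X in _ *+ X]card_ord -sumr_const.
  by apply: ler_sum => j _; apply: EB.
(* With 1 written as the average of a constant, [X] is chosen first so that the remaining average
   over [Y] is below 1, and then [Y]. *)
have [X bX GX] := colavg_lt (enum_uniq V1) sz1
  (eq_ind_r (fun u => _ < u) EG (colavg_cst 1 sz1)).
have [Y bY GXY] := colavg_lt (enum_uniq V2) sz2
  (eq_ind_r (fun u => _ < u) GX (colavg_cst 1 sz2)).
exists X, Y; split=> // i j.
have FA0 (A : {set V1}) Y' : 0 <= FA A Y' by apply/ltW/exp_gt0.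
have FB0 (B : {set V2}) X' : 0 <= FB B X' by apply/ltW/exp_gt0.
have neg x : exp (s * x) < 1 -> x < 0.
  rewrite !ltNge; apply: contra => x0; apply: le_trans (exp_ge1Dx _).
  by rewrite lerDl mulr_ge0.
have : FA (X i) Y < 1.
  apply: le_lt_trans GXY; rewrite /G (bigD1 i) //= -addrA lerDl.
  by rewrite addr_ge0 ?sumr_ge0.
have : FB (Y j) X < 1.
  apply: le_lt_trans GXY; rewrite /G addrC (bigD1 j) //= -addrA lerDl.
  by rewrite addr_ge0 ?sumr_ge0.
move=> /neg + /neg; rewrite -(ltr_nat R) natrD.
by move: (_%:R) (_%:R) (n%:R) => x y N; lra.
Qed.

Lemma card_bad_le (T : finType) (k m d : nat) (P : pred {set T}) (p : R) :
  #|T| = m -> p * 'C(m, k)%:R <= d%:R ->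
  (d <= #|[set B : {set T} | (#|B| == k) && ~~ P B]|)%N ->
  #|[set B : {set T} | (#|B| == k) && P B]|%:R <= (1 - p) * 'C(m, k)%:R.
Proof.
move=> cT pd dle.
have : (#|[set B : {set T} | (#|B| == k) && P B]| + d <= 'C(m, k))%N.
  rewrite -cT -card_draws -[leqRHS](cardsID [set B | P B]) leq_add //.
    by apply/subset_leq_card/subsetP => B; rewrite !inE.
  apply: leq_trans dle _.
  by apply/subset_leq_card/subsetP => B; rewrite !inE andbC.
rewrite -(ler_nat R) natrD; lra.
Qed.

Lemma hamilton_of_degrees (n a b : nat) (V1 V2 : finType)
    (H : {set {set (V1 + V2)}}) (alpha s : R) :
  (0 < a)%N -> (0 < b)%N -> (5 <= n)%N ->
  #|V1| = (a * n)%N -> #|V2| = (b * n)%N -> in_bip_family a b H ->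
  0 < alpha -> alpha < 1 -> 0 <= s -> n%:R * s ^+ 2 = ln n%:R ->
  (forall A : {set V1}, #|A| = a ->
     (alpha + 4 * s) * 'C(b * n, b)%:R <= (degA H A)%:R) ->
  (forall B : {set V2}, #|B| = b ->
     (1 - alpha + 4 * s) * 'C(a * n, a)%:R <= (degB H B)%:R) ->
  has_hamilton_ab_cycle a b H.
Proof.
move=> a0 b0 n5 cV1 cV2 HH al0 al1 s0 ns dA dB.
pose bad A B := join A B \notin H.
have [||X [Y [bX bY XY]]] :=
    @blocks_exist n a b V1 V2 bad alpha s n5 a0 b0 cV1 cV2 al0 al1 s0 ns.
- move=> A cA; rewrite -addrA -opprD; apply: (card_bad_le cV2 (dA A cA)).
  rewrite (leq_trans (degA_le HH cA)) //.
  by apply/subset_leq_card/subsetP => B; rewrite !inE negbK.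
- move=> B cB; have -> : alpha - 4 * s = 1 - (1 - alpha + 4 * s) by lra.
  apply: (card_bad_le cV1 (dB B cB)).
  rewrite (leq_trans (degB_le HH cB)) //.
  by apply/subset_leq_card/subsetP => A; rewrite !inE negbK.
(* A degree is [n] minus the number of non-neighbours; two such numbers add up to less than [n], so
   the degrees add up to more than [n]. *)
have [x y|c [cc uc allc]] :=
    moon_moser (block_adj_sym H X Y) (@block_adj_alt _ _ _ H X Y).
  move: x y => [i|i] [j|j] // _.
    have := block_degA H X Y i; have := block_degB H X Y j; have := XY i j.
    rewrite /bad; lia.
  have := block_degA H X Y j; have := block_degB H X Y i; have := XY j i.
  rewrite /bad; lia.
have n0 : (0 < n)%N by apply: leq_trans n5.
exact: (hamilton_of_block_cycle a0 b0 n0 cV1 cV2 bX bY cc uc allc).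
Qed.

Lemma IZR4 : IZR 4 = 4.
Proof. by rewrite IZRposE INRE. Qed.

(** Together with nonnegativity, this is all that the argument uses about the value of [s]. *)
Lemma mul_sqr_sqrt_ln n : (1 < n)%N ->
  n%:R * sqrt (ln n%:R / n%:R) ^+ 2 = ln n%:R.
Proof.
move=> n0; have nR : 0 < n%:R :> R by rewrite ltr0n ltnW.
have ln0 : 0 <= ln n%:R.
  have <- : ln 1 = 0 by exact: ln_1.
  apply/ltW/RltP/ln_increasing; first exact: Rlt_0_1.
  by apply/RltP; rewrite ltr1n.
rewrite RsqrtE sqr_sqrtr; last exact: divr_ge0 ln0 (ltW nR).
by rewrite mulrC divfK // lt0r_neq0.
Qed.
End RandomBlocks.

Theorem theorem1p3 (n a b : nat) (V1 V2 : finType)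
  (H : {set {set (V1 + V2)}}) :
  (1 <= n)%N -> (1 <= a)%N -> (1 <= b)%N -> (5 <= n)%N ->
  #|V1| = (a * n)%N -> #|V2| = (b * n)%N ->
  in_bip_family a b H ->
  (exists alpha : R, (0 < alpha)%R /\ (alpha < 1)%R /\
     (forall A : {set V1}, #|A| = a ->
        ((alpha + 4 * sqrt (ln (INR n) / INR n)) * INR 'C(b * n, b)
           <= INR (degA H A))%R) /\
     (forall B : {set V2}, #|B| = b ->
        ((1 - alpha + 4 * sqrt (ln (INR n) / INR n)) * INR 'C(a * n, a)
           <= INR (degB H B))%R)) ->
  has_hamilton_ab_cycle a b H.
Proof.
move=> n0 a0 b0 n5 cV1 cV2 HH [alpha [/RltP al0 [/RltP al1 [dA dB]]]].
apply: (hamilton_of_degrees a0 b0 n5 cV1 cV2 HH al0 al1 _ (mul_sqr_sqrt_ln _)).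
- exact/RleP/sqrt_pos.
- exact: leq_trans n5.
- by move=> A cA; apply/RleP; move: (dA A cA); rewrite !INRE IZR4.
- by move=> B cB; apply/RleP; move: (dB B cB); rewrite !INRE IZR4.
Qed.
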